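(* (''Seinfeld Production'') Pick any Octonion index $o\in\{1,\dots,7\}$ (7 ways), then any pure Sedenion index $S\in\{8,\dots,15\}$ which is neither $8$ nor $8\oplus o$ (6 ways). The rest follows: by sequential execution of the production rules, a complete interconnected box-kite system can be unfolded from $o$ and $S$. Alternatively, pick any pure Sedenion index $S\in\{9,\dots,15\}$ (7 ways), then any Octonion index $o\in\{1,\dots,7\}$ with $o\neq S\oplus 8$ (6 ways); the rest follows in the same way.
   Context: The Sedenions are the 16-dimensional real (non-associative, distributive) algebra with basis $1,i_1,\dots,i_{15}$, where $1$ is the unit, $i_n^2=-1$, $i_mi_n=-i_ni_m$ for $m\ne n$, and for each triplet $(a,b,c)$ in the following lists $i_ai_b=i_c$, $i_bi_c=i_a$, $i_ci_a=i_b$. O-trips: (1,2,3),(1,4,5),(1,7,6),(2,4,6),(2,5,7),(3,4,7),(3,6,5). S-trips: (1,8,9),(1,11,10),(1,13,12),(1,14,15),(2,8,10),(2,9,11),(2,14,12),(2,15,13),(3,8,11),(3,10,9),(3,15,12),(3,13,14),(4,8,12),(4,9,13),(4,10,14),(4,11,15),(5,8,13),(5,12,9),(5,10,15),(5,14,11),(6,8,14),(6,15,9),(6,12,10),(6,11,13),(7,8,15),(7,9,14),(7,13,10),(7,12,11). Thus $i_mi_n=\pm i_{m\oplus n}$ for $m\neq n$, where $\oplus$ is bitwise XOR. Indices $1,\dots,7$ are Octonion indices; $8,\dots,15$ are pure Sedenion indices; the index-8 unit is called the 8-Ball. Two pairs $(A,B)$, $(C,D)$ of distinct indices are Co-Assessors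 if $(i_A+s\,i_B)(i_C+t\,i_D)=0$ for some signs $s,t\in\{+1,-1\}$; a pair is an Assessor if it is a Co-Assessor of some pair. There are 42 Assessors, each consisting of one Octonion index and one pure Sedenion index. For each O-trip $(a,b,c)$ the associated automorpheme is the set of seven indices consisting of $a,b,c$ and the four pure Sedenion indices other than $8,8\oplus a,8\oplus b,8\oplus c$. A box-kite is a set of six Assessors placed at the vertices of an octahedron so that Assessors joined by an edge are Co-Assessors and Assessors at opposite vertices are not; there are seven box-kites, which partition the 42 Assessors, and together they form the complete box-kite system. The production rules are the following. Rule #1: given Co-Assessors $(A,B)$, $(C,D)$, a new Assessor $(E,F)$, which is a Co-Assessor of both, is obtained by letting $E$ and $F$ be the two distinct XORs $A\oplus C=B\oplus D$ and $A\oplus D=B\oplus C$. Rule #2 (twisting): given Co-Assessors $(A,B)$, $(C,D)$, precisely two new Assessors, Co-Assessors of each other but of neither progenitor, are obtained by exchanging one index of the first with one index of the second (exactly one of the two possible exchanges, giving $(A,D),(C,B)$ or $(D,B),(C,A)$, works) and flipping the sign attached to one unit. Rule #3: given an Assessor $(a,B)$ (with $a$ an Octonion index, $B$ a pure Sedenion index) in the automorpheme of one O-trip $\{a,c,e\}$, there is exactly one other automorpheme, of some O-trip $\{a,m,n\}$, containing both $a$ and $B$; it also contains the Assessor $(a,B)$, and the Co-Assessors of $(a,B)$ there are found by taking either new O-trip index, say $m$, and solving $(i_a+i_B)(i_m+s\,i_{S'})=0$ for the pure Sedenion index $S'$ and the sign $s$. *)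

(* Defs.v *)
From Stdlib Require Import Relation_Operators.
From mathcomp Require Import all_boot all_order all_algebra.
From mathcomp Require Import reals.

Set Implicit Arguments.
Unset Strict Implicit.
Unset Printing Implicit Defensive.

Import GRing.Theory.
Local Open Scope ring_scope.

(* Index 0 is the real unit 1; index n >= 1 is the imaginary unit i_n. *)
Notation idx := 'I_16.

Definition octonion_indices : {set idx} := [set i : idx | (1 <= i <= 7)%N].
Definition sedenion_indices : {set idx} := [set i : idx | (8 <= i)%N].
Definition eight_ball : idx := inord 8.

(* Bitwise XOR; the XOR of two numbers below 16 is below 16, so inord never
   falls back on its default value. *)
Definition ixor (m n : idx) : idx := inord (Nat.lxor m n).

Notation trip := (nat * nat * nat)%type.

Definition O_trips : seq trip :=
  [:: (1, 2, 3); (1, 4, 5); (1, 7, 6); (2, 4, 6); (2, 5, 7); (3, 4, 7);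
      (3, 6, 5)]%N.

Definition S_trips : seq trip :=
  [:: (1, 8, 9); (1, 11, 10); (1, 13, 12); (1, 14, 15);
      (2, 8, 10); (2, 9, 11); (2, 14, 12); (2, 15, 13);
      (3, 8, 11); (3, 10, 9); (3, 15, 12); (3, 13, 14);
      (4, 8, 12); (4, 9, 13); (4, 10, 14); (4, 11, 15);
      (5, 8, 13); (5, 12, 9); (5, 10, 15); (5, 14, 11);
      (6, 8, 14); (6, 15, 9); (6, 12, 10); (6, 11, 13);
      (7, 8, 15); (7, 9, 14); (7, 13, 10); (7, 12, 11)]%N.

Definition rotations (t : trip) : seq trip :=
  let: (a, b, c) := t in [:: (a, b, c); (b, c, a); (c, a, b)].

(* trip_third m n is Some c exactly when the trips give i_m i_n = + i_c. *)
Definition trip_third (m n : nat) : option nat :=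
  ohead [seq t.2 | t <- flatten (map rotations (O_trips ++ S_trips))
                 & t.1 == (m, n)].
Arguments trip_third : simpl never.

Notation sedenion R := 'rV[R]_16.

Definition unit_of (R : realType) (n : idx) : sedenion R := delta_mx 0 n.

(* The final default 0 is never reached: each pair of distinct indices in
   1..15 occurs in exactly one trip. *)
Definition unit_mul (R : realType) (m n : idx) : sedenion R :=
  if m == ord0 then unit_of R n
  else if n == ord0 then unit_of R m
  else if m == n then - unit_of R ord0
  else if trip_third m n is Some c then unit_of R (inord c)
  else if trip_third n m is Some c then - unit_of R (inord c)
  else 0.

Definition sed_mul (R : realType) (x y : sedenion R) : sedenion R :=
  \sum_(m : idx) \sum_(n : idx) (x ord0 m * y ord0 n) *: unit_mul R m n.

(* i_A + i_B for s = false, i_A - i_B for s = true. *)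
Definition diagonal (R : realType) (A : idx) (s : bool) (B : idx) :
  sedenion R := unit_of R A + (-1) ^+ s *: unit_of R B.

(* (i_A + s i_B) (i_C + t i_D) = 0 *)
Definition zero_product (R : realType) (A : idx) (s : bool) (B : idx)
    (C : idx) (t : bool) (D : idx) : bool :=
  sed_mul (diagonal R A s B) (diagonal R C t D) == 0.

(* Pairs of indices are unordered, represented by two-element sets:
   i_B + s i_A is a multiple of i_A + s i_B. *)
Notation ipair := {set idx}.

Definition co_assessors (R : realType) (p q : ipair) : bool :=
  [exists A : idx, exists B : idx, exists C : idx, exists D : idx,
   [&& [&& A != ord0, B != ord0, C != ord0 & D != ord0],
       A != B, C != D, p == [set A; B], q == [set C; D] &
       [exists s : bool, exists t : bool, zero_product R A s B C t D]]].

Definition assessors (R : realType) : {set ipair} :=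
  [set p : ipair | [exists q : ipair, co_assessors R p q]].

(* The vertices of the octahedron are written (k, b), for the two ends b of
   each of its three axes k: vertices on different axes are joined by an edge,
   those at the two ends of one axis are opposite. *)
Definition box_kite (R : realType) (K : {set ipair}) : bool :=
  [exists v : {ffun 'I_3 * bool -> ipair},
   [&& injectiveb v, K == [set v x | x : 'I_3 * bool], K \subset assessors R,
       [forall x : 'I_3 * bool, forall y : 'I_3 * bool,
          (x.1 != y.1) ==> co_assessors R (v x) (v y)] &
       [forall k : 'I_3, ~~ co_assessors R (v (k, true)) (v (k, false))
                      && ~~ co_assessors R (v (k, false)) (v (k, true))]]].

Definition box_kites (R : realType) : {set {set ipair}} :=
  [set K : {set ipair} | box_kite R K].

Definition trip_set (t : trip) : {set idx} :=
  let: (a, b, c) := t in [set inord a; inord b; inord c].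

Definition automorpheme (t : trip) : {set idx} :=
  trip_set t :|:
  [set S in sedenion_indices | (S != eight_ball) &
     [forall a in trip_set t, S != ixor eight_ball a]].

(* produces R T N: one application of a production rule to Assessors in T
   yields the pairs in N.

   As pairs are unordered, A, B, C, D range over all namings of the indices of
   the two progenitors, so the single form {A, D}, {C, B} of the exchange in
   rule2 covers both possible exchanges. There B and D carry their signs s and
   t along, and one sign is flipped; flipping the sign of the other unit in
   the same factor only negates that factor. *)
Inductive produces (R : realType) (T : {set ipair}) : {set ipair} -> Prop :=
| rule1 (A B C D : idx) :
    [set A; B] \in T -> [set C; D] \in T ->
    co_assessors R [set A; B] [set C; D] ->
    produces R T [set [set ixor A C; ixor A D]]
| rule2 (A B C D : idx) (s t : bool) :
    [set A; B] \in T -> [set C; D] \in T ->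
    co_assessors R [set A; B] [set C; D] ->
    zero_product R A s B C t D ->
    zero_product R A (~~ t) D C s B \/ zero_product R A t D C (~~ s) B ->
    produces R T [set [set A; D]; [set C; B]]
| rule3 (a B m S' : idx) (s : bool) (u u' : trip) :
    [set a; B] \in T -> [set a; B] \in assessors R ->
    a \in octonion_indices -> B \in sedenion_indices ->
    u \in O_trips -> a \in trip_set u -> B \in automorpheme u ->
    u' \in O_trips -> a \in trip_set u' -> B \in automorpheme u' ->
    u' != u ->
    m \in trip_set u' -> m != a -> S' \in sedenion_indices ->
    zero_product R a false B m s S' ->
    produces R T [set [set m; S']].

Definition production_step (R : realType) (T T' : {set ipair}) : Prop :=
  exists2 N : {set ipair}, produces R T N & T' = T :|: N.

Definition unfolds (R : realType) : {set ipair} -> {set ipair} -> Prop :=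
  clos_refl_trans {set ipair} (production_step R).

Definition linked (R : realType) (Ks : {set {set ipair}})
    (K K' : {set ipair}) : Prop :=
  [/\ K \in Ks, K' \in Ks &
      exists2 N : {set ipair}, produces R K N & N \subset K'].

Definition interconnected (R : realType) (Ks : {set {set ipair}}) : Prop :=
  forall K K' : {set ipair}, K \in Ks -> K' \in Ks ->
  clos_refl_trans {set ipair} (linked R Ks) K K'.

Definition complete_box_kite_system (R : realType)
    (Ks : {set {set ipair}}) : Prop :=
  [/\ Ks = box_kites R, #|Ks| = 7%N, partition Ks (assessors R) &
      #|assessors R| = 42%N].

Definition system_unfolds_from (R : realType) (o S : idx) : Prop :=
  exists Ks : {set {set ipair}},
  [/\ complete_box_kite_system R Ks, interconnected R Ks &
      unfolds R [set [set o; S]] (cover Ks)].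

Definition sedenion_choices (o : idx) : {set idx} :=
  [set S in sedenion_indices | (S != eight_ball) & (S != ixor eight_ball o)].

Definition octonion_choices (S : idx) : {set idx} :=
  [set o in octonion_indices | o != ixor S eight_ball].

(* Main.v *)
(* Products of units are i_m i_n = +-i_(m+n), with + the XOR of indices, so
   (i_A + s i_B)(i_C + t i_D) vanishes only if A+C = B+D and the four signs are
   compatible. Hence being Co-Assessors is a finite condition: the Assessors
   are the pairs {o, 8+s+o} for distinct Octonion indices s and o, and
   {o, 8+s+o}, {p, 8+s'+p} are Co-Assessors iff s = s' and p is neither o nor
   s+o. Each s thus gives one octahedron, and these are the seven box-kites.
   Rule #3 reaches all Co-Assessors of an Assessor, hence its whole box-kite,
   and Rule #2 leads from any box-kite to any other one; so a nonempty set of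
   Assessors which is not yet everything can always be enlarged. *)
Require Import Defs.
From Stdlib Require Import PeanoNat Relation_Operators.
From mathcomp Require Import all_boot all_order all_algebra.
From mathcomp Require Import reals.

Set Implicit Arguments.
Unset Strict Implicit.
Unset Printing Implicit Defensive.

Import GRing.Theory Num.Theory.

(** * Exhaustive checks over the sixteen indices *)

Lemma all_iota_ord n (P : pred nat) :
  all P (iota 0 n) -> forall i : 'I_n, P i.
Proof. by move=> /allP allP i; apply: allP; rewrite mem_iota ltn_ord. Qed.

(** Index statements are restated over [nat], so that they become closed booleans for [vm_compute];
    ordinals built with [inord] do not evaluate well. *)
Definition all16 (P : pred nat) : bool := all P (iota 0 16).

Lemma all16P (P : pred nat) : all16 P -> forall i : idx, P i.
Proof. exact: all_iota_ord. Qed.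

Lemma all16P2 (P : nat -> nat -> bool) :
  all16 (fun i => all16 (P i)) -> forall i j : idx, P i j.
Proof. by move=> /all16P P16 i j; apply: all16P (P16 i) j. Qed.

Lemma all16P3 (P : nat -> nat -> nat -> bool) :
  all16 (fun i => all16 (fun j => all16 (P i j))) ->
  forall i j k : idx, P i j k.
Proof. by move=> /all16P2 P16 i j k; apply: all16P (P16 i j) k. Qed.

Lemma all16P4 (P : nat -> nat -> nat -> nat -> bool) :
  all16 (fun i => all16 (fun j => all16 (fun k => all16 (P i j k)))) ->
  forall i j k l : idx, P i j k l.
Proof. by move=> /all16P3 P16 i j k l; apply: all16P (P16 i j k) l. Qed.

Lemma card_set_ord n (P : pred nat) :
  #|[set i : 'I_n | P i]| = count P (iota 0 n).
Proof.
by rewrite cardsE cardE /enum_mem size_filter -enumT -val_enum_ord count_map.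
Qed.

(** * Multiplication of units *)

Lemma val_ixor (m n : idx) : ixor m n = Nat.lxor m n :> nat.
Proof.
rewrite inordK //.
by apply: (all16P2 (P := fun m n => Nat.lxor m n < 16)); vm_compute.
Qed.

Lemma val_eight_ball : eight_ball = 8 :> nat.
Proof. by rewrite inordK. Qed.

Lemma ixor_injr (m : idx) : injective (ixor m).
Proof.
move=> n p /(congr1 val); rewrite /= !val_ixor => eq_mn; apply/eqP.
suff: (Nat.lxor m n == Nat.lxor m p) ==> (n == p :> nat).
  by rewrite eq_mn eqxx.
apply: (all16P3 (P := fun m n p =>
  (Nat.lxor m n == Nat.lxor m p) ==> (n == p))).
by vm_compute.
Qed.

Lemma ixorC : commutative ixor.
Proof. by move=> m n; apply: val_inj; rewrite /= !val_ixor Nat.lxor_comm. Qed.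

Lemma ixorA : associative ixor.
Proof.
by move=> m n p; apply: val_inj; rewrite /= !val_ixor Nat.lxor_assoc.
Qed.

Lemma ixor0 (m : idx) : ixor m ord0 = m.
Proof. by apply: val_inj; rewrite /= val_ixor Nat.lxor_0_r. Qed.

Lemma ixorK (m : idx) : cancel (ixor m) (ixor m).
Proof.
by move=> n; apply: val_inj; rewrite /= !val_ixor -Nat.lxor_assoc
  Nat.lxor_nilpotent Nat.lxor_0_l.
Qed.

(** The exponent of -1 in i_m i_n: a minus sign comes from the square of an imaginary unit, or from
    a pair that the trips list in the reverse order. *)
Definition mul_sign (m n : nat) : bool :=
  [&& m != 0, n != 0 & (m == n) || (trip_third m n == None)].

Local Open Scope ring_scope.

(** * Bilinearity of the product and the zero-product criterion *)

Section SedenionAlgebra.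
Variable R : realType.
Implicit Types x y z : sedenion R.

Lemma unit_mulE (m n : idx) :
  unit_mul R m n = (-1) ^+ mul_sign m n *: unit_of R (ixor m n).
Proof.
rewrite /unit_mul /mul_sign -!val_eqE /=.
case: eqVneq => [m0|nz_m] /=.
  have -> : m = ord0 by apply: val_inj.
  by rewrite ixorC ixor0 scale1r.
case: eqVneq => [n0|nz_n] /=.
  have -> : n = ord0 by apply: val_inj.
  by rewrite ixor0 scale1r.
case: eqVneq => [mn|ne_mn] /=.
  rewrite (val_inj mn : m = n) scaleN1r; congr (- unit_of _ _).
  by apply: val_inj; rewrite /= val_ixor Nat.lxor_nilpotent.
(* The one fact about the trip tables: two distinct imaginary indices occur in a trip, in one order
   or the other, and its third index is their XOR. *)
have: [&& m != 0 :> nat, n != 0 :> nat & m != n :> nat]%N ==>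
    (if trip_third m n is Some c then c == Nat.lxor m n
     else trip_third n m == Some (Nat.lxor m n)).
  apply: (all16P2 (P := fun m n => [&& m != 0, n != 0 & m != n]%N ==>
    (if trip_third m n is Some c then c == Nat.lxor m n
     else trip_third n m == Some (Nat.lxor m n)))).
  by vm_compute.
rewrite nz_m nz_n ne_mn /=; case: (trip_third m n) => [c /eqP->|/eqP->] /=.
  by rewrite scale1r.
by rewrite scaleN1r.
Qed.

Lemma sed_mulDl x y z : sed_mul (x + y) z = sed_mul x z + sed_mul y z.
Proof.
rewrite -big_split; apply: eq_bigr => m _; rewrite -big_split.
by apply: eq_bigr => n _; rewrite mxE mulrDl scalerDl.
Qed.

Lemma sed_mulDr x y z : sed_mul x (y + z) = sed_mul x y + sed_mul x z.
Proof.
rewrite -big_split; apply: eq_bigr => m _; rewrite -big_split.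
by apply: eq_bigr => n _; rewrite mxE mulrDr scalerDl.
Qed.

Lemma sed_mulZl a x y : sed_mul (a *: x) y = a *: sed_mul x y.
Proof.
rewrite scaler_sumr; apply: eq_bigr => m _; rewrite scaler_sumr.
by apply: eq_bigr => n _; rewrite mxE scalerA mulrA.
Qed.

Lemma sed_mulZr a x y : sed_mul x (a *: y) = a *: sed_mul x y.
Proof.
rewrite scaler_sumr; apply: eq_bigr => m _; rewrite scaler_sumr.
by apply: eq_bigr => n _; rewrite mxE scalerA mulrCA.
Qed.

Lemma sed_mul_unit (m n : idx) :
  sed_mul (unit_of R m) (unit_of R n) = unit_mul R m n.
Proof.
have unitE (k l : idx) : unit_of R k ord0 l = (l == k)%:R by rewrite mxE.
rewrite /sed_mul (big_only1 m) // => [|p /negPf mp _].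
  rewrite (big_only1 n) // => [|q /negPf nq _].
    by rewrite !unitE !eqxx mulr1 scale1r.
  by rewrite !unitE nq mulr0 scale0r.
by apply: big1 => q _; rewrite unitE mp mul0r scale0r.
Qed.

Lemma signrD_eq0 (b c : bool) :
  ((-1) ^+ b + (-1) ^+ c == 0 :> R) = b (+) c.
Proof.
by case: b; case: c; rewrite ?addNr ?subrr ?eqxx //= -?opprD ?oppr_eq0
  paddr_eq0 ?ler01 // oner_eq0.
Qed.

(* A conditional, unlike a conjunction, does not evaluate the signs when the
   indices differ. *)
Definition zero_productn (A : nat) (s : bool) (B C : nat) (t : bool)
    (D : nat) : bool :=
  if Nat.lxor A C == Nat.lxor B D then
    (mul_sign A C (+) (s (+) t (+) mul_sign B D))
    && (t (+) mul_sign A D (+) (s (+) mul_sign B C))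
  else false.

(* The four products of units have indices A+C, A+D, B+C, B+D (in XOR), where
   consecutive sides differ, so they can only cancel along the diagonals. *)
Lemma zero_productE (A B C D : idx) (s t : bool) : A != B -> C != D ->
  zero_product R A s B C t D = zero_productn A s B C t D.
Proof.
move=> neAB neCD.
have nACAD : (ixor A C == ixor A D) = false.
  by rewrite (inj_eq (@ixor_injr A)) (negPf neCD).
have nACBC : (ixor A C == ixor B C) = false.
  by rewrite ![ixor _ C]ixorC (inj_eq (@ixor_injr C)) (negPf neAB).
have eq_diag : ixor A C = ixor B D -> ixor A D = ixor B C.
  move=> eqAC; apply: (@ixor_injr A); rewrite ixorK ixorA (ixorC A) -ixorA.
  by rewrite eqAC ixorK.
rewrite /zero_product /zero_productn /diagonal.
rewrite sed_mulDl !sed_mulDr !sed_mulZl !sed_mulZr !sed_mul_unit !unit_mulE.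
rewrite !scalerA -!signr_addb -!val_ixor val_eqE.
move: mul_sign => sg.
move: (sg A C) (t (+) sg A D) (s (+) sg B C) => a b c.
move: (s (+) t (+) sg B D) => d.
case: (eqVneq (ixor A C)) => [eqAC|neAC] /=.
  rewrite -eqAC -eq_diag //.
  rewrite [X in _ + X == _]addrC addrACA -!scalerDl.
  (* Only the units A+C and A+D remain, each with a sum of two signs as coefficient. *)
  apply/eqP/andP => [/rowP e0|[]].
    move: (e0 (ixor A C)) (e0 (ixor A D)).
    rewrite !mxE !eqxx nACAD eq_sym nACAD !mulr1 !mulr0 addr0 add0r.
    by move=> /eqP + /eqP; rewrite !signrD_eq0.
  rewrite -!signrD_eq0 => /eqP-> /eqP->.
  by rewrite !scale0r addr0.
(* Here a single product contributes to the coordinate A+C, which is therefore a sign and not 0. *)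
apply/negbTE/eqP => /rowP/(_ (ixor A C)) /eqP.
rewrite !mxE !eqxx nACAD nACBC (negPf neAC) !mulr0 !addr0 mulr1.
by rewrite signr_eq0.
Qed.

End SedenionAlgebra.

(** * Assessors and box-kites *)

Local Close Scope ring_scope.

(* The Assessors of one box-kite are the pairs {o, 8 + s + o} (in XOR), where
   the strut constant s is the Octonion index missing from the box-kite;
   opposite vertices have Octonion indices o and s + o. *)
Definition partner (s o : idx) : idx := ixor (ixor eight_ball s) o.

Definition assessor (s o : idx) : ipair := [set o; partner s o].

Definition vertex (s o : nat) : bool := [&& 0 < s < 8, 0 < o < 8 & o != s].

Definition edge (s o p : nat) : bool :=
  [&& vertex s o, vertex s p, p != o & p != Nat.lxor s o].

Definition partnern (s o : nat) : nat := Nat.lxor (Nat.lxor 8 s) o.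

Lemma val_partner (s o : idx) : partner s o = partnern s o :> nat.
Proof. by rewrite !val_ixor val_eight_ball. Qed.

(** The identity behind twisting: exchanging the pure Sedenion indices of the Assessors at [o] and
    o+s+s' turns the strut constant [s] into [s']. *)
Lemma partner_ixor (s s' o : idx) :
  partner s (ixor o (ixor s s')) = partner s' o.
Proof.
rewrite /partner -!ixorA; congr ixor.
by rewrite [ixor o _]ixorC -ixorA ixorK.
Qed.

(** As [s] and [o] are distinct and below 8, their XOR is nonzero and below 8; XOR with 8 then adds
    8. *)
Lemma partnern_ge8 (s o : idx) : vertex s o -> 8 < partnern s o.
Proof.
apply: implyP; apply: (all16P2 (P := fun s o =>
  vertex s o ==> (8 < partnern s o))).
by vm_compute.
Qed.

Lemma vertex_neq_partner (s o : idx) : vertex s o -> o != partner s o.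
Proof.
move=> so; rewrite -val_eqE /= val_partner; apply/eqP => e.
by have := partnern_ge8 so; rewrite -e; case/and3P: so => _ /andP[_ ?] _;
  rewrite ltnNge ltnW.
Qed.

(** The index below 8 identifies [o] within the unordered pair; the other index then yields [s] by
    cancellation. *)
Lemma assessor_inj (s o s' o' : idx) : vertex s o -> vertex s' o' ->
  assessor s o = assessor s' o' -> s = s' /\ o = o'.
Proof.
move=> so so' eqa.
have lt8 (u v : idx) : vertex u v -> v < 8 by case/and3P=> _ /andP[].
have eqo : o = o'.
  have: o \in assessor s' o' by rewrite -eqa set21.
  case/set2P => // e; have := lt8 _ _ so.
  by rewrite e val_partner ltnNge ltnW // partnern_ge8.
split=> //; rewrite -eqo in eqa so' *.
have: partner s o \in assessor s' o by rewrite -eqa set22.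
case/set2P => [e|].
  by have := vertex_neq_partner so; rewrite e eqxx.
by rewrite /partner ![ixor _ o]ixorC => /ixor_injr/ixor_injr.
Qed.

(** The strut constant is solved from B = 8+s+A (in XOR); the result need not be a vertex. *)
Lemma set2_assessor (A B : idx) :
  [set A; B] = assessor (ixor eight_ball (ixor A B)) A.
Proof. by rewrite /assessor /partner ixorK [ixor _ A]ixorC ixorK. Qed.

Section BoxKites.
Variable R : realType.

(** * Co-Assessors as the edges of octahedra *)

Lemma co_assessors_zero_product (A B C D : idx) (s t : bool) :
  A != ord0 -> B != ord0 -> C != ord0 -> D != ord0 -> A != B -> C != D ->
  zero_product R A s B C t D -> co_assessors R [set A; B] [set C; D].
Proof.
move=> A0 B0 C0 D0 AB CD zp; apply/existsP; exists A; apply/existsP; exists B.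
apply/existsP; exists C; apply/existsP; exists D.
rewrite A0 B0 C0 D0 AB CD !eqxx /=; apply/existsP; exists s.
by apply/existsP; exists t.
Qed.

(* The two sign conditions of zero_productn constrain only s (+) t. *)
Definition sign_compatible (A B C D : nat) : bool :=
  if Nat.lxor A C == Nat.lxor B D then
    mul_sign A C (+) mul_sign B D == mul_sign A D (+) mul_sign B C
  else false.

(** Each sign condition determines [s (+) t]; equating the two values eliminates the signs. *)
Lemma zero_product_compatible (A B C D : nat) (s t : bool) :
  zero_productn A s B C t D -> sign_compatible A B C D.
Proof.
rewrite /zero_productn /sign_compatible; move: mul_sign => sg.
case: ifP => // _.
by case: (sg A C); case: (sg B D); case: (sg A D); case: (sg B C);
  case: s; case: t.
Qed.

Lemma sign_compatible_edge (A B C D : idx) :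
  A != ord0 -> B != ord0 -> C != ord0 -> D != ord0 -> A != B -> C != D ->
  sign_compatible A B C D ->
  exists s o p : idx,
    [/\ edge s o p, [set A; B] = assessor s o & [set C; D] = assessor s p].
Proof.
(* The smaller index of a pair is taken as its Octonion index. *)
have minE (E F : idx) : [set E; F] =
    assessor (ixor eight_ball (ixor E F)) (if E < F then E else F).
  case: ifP => _; first exact: set2_assessor.
  by rewrite setUC [ixor E F]ixorC; apply: set2_assessor.
move=> A0 B0 C0 D0 AB CD zp.
pose s := ixor eight_ball (ixor A B).
pose chk (A B C D : nat) := [&& 0 < A, 0 < B, 0 < C, 0 < D, A != B, C != D &
    sign_compatible A B C D] ==>
  (Nat.lxor A B == Nat.lxor C D) &&
  edge (Nat.lxor 8 (Nat.lxor A B)) (minn A B) (minn C D).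
have: chk A B C D by apply: (all16P4 (P := chk)); vm_compute.
rewrite /chk !lt0n A0 B0 C0 D0 AB CD zp /= => /andP[/eqP eqS ed].
exists s, (if A < B then A else B), (if C < D then C else D).
have eqs : s = ixor eight_ball (ixor C D).
  by apply: val_inj; rewrite /= /s !val_ixor eqS.
split; [|exact: minE|by rewrite eqs; apply: minE].
rewrite /s !val_ixor val_eight_ball; move: ed; rewrite /minn.
by case: ifP; case: ifP.
Qed.

(** The first sign can be fixed to +, as Rule #3 demands, since only the product of the two signs
    matters. *)
Lemma edge_zero_product (s o p : idx) : edge s o p ->
  exists t, zero_product R o false (partner s o) p t (partner s p).
Proof.
move=> sop; have [so sp] : vertex s o /\ vertex s p by case/and4P: sop.
pose chk (s o p : nat) := if edge s o p then has (fun t =>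
  zero_productn o false (partnern s o) p t (partnern s p)) [:: false; true]
  else true.
have: chk s o p by apply: (all16P3 (P := chk)); vm_compute.
rewrite /chk sop => /hasP[t _ zp]; exists t.
rewrite zero_productE; [|exact: vertex_neq_partner|exact: vertex_neq_partner].
by rewrite !val_partner.
Qed.

Lemma co_assessorsP (a b : ipair) :
  reflect (exists s o p : idx,
             [/\ edge s o p, a = assessor s o & b = assessor s p])
          (co_assessors R a b).
Proof.
apply: (iffP idP) => [|[s [o [p [sop -> ->]]]]].
  move=> /existsP[A /existsP[B /existsP[C /existsP[D]]]].
  case/andP=> /and4P[A0 B0 C0 D0] /and5P[AB CD /eqP-> /eqP->].
  case/existsP=> s /existsP[t]; rewrite zero_productE //.
  by move=> /zero_product_compatible; apply: sign_compatible_edge.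
have [t zp] := edge_zero_product sop.
have [so sp] : vertex s o /\ vertex s p by case/and4P: sop.
have nz (q : idx) : vertex s q -> (q != ord0) && (partner s q != ord0).
  move=> sq; rewrite -!val_eqE /= val_partner -!lt0n.
  rewrite (leq_trans _ (partnern_ge8 sq)) // andbT.
  by case/and3P: sq => _ /andP[].
have [/andP[o0 o0'] /andP[p0 p0']] := (nz _ so, nz _ sp).
by apply: co_assessors_zero_product zp => //; apply: vertex_neq_partner.
Qed.

Lemma co_assessors_edge (s o p : idx) : edge s o p ->
  co_assessors R (assessor s o) (assessor s p).
Proof. by move=> sop; apply/co_assessorsP; exists s, o, p. Qed.

Lemma co_assessorsE (s o p : idx) : vertex s o -> vertex s p ->
  co_assessors R (assessor s o) (assessor s p) = edge s o p.
Proof.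
move=> so sp; apply/idP/idP => [|/co_assessors_edge //].
case/co_assessorsP=> s' [o' [p' [ed eo ep]]].
have [so' sp'] : vertex s' o' /\ vertex s' p' by case/and4P: ed.
have [-> ->] := assessor_inj so so' eo.
by have [_ ->] := assessor_inj sp sp' ep.
Qed.

Lemma edge_exists (s o : idx) : vertex s o -> exists p : idx, edge s o p.
Proof.
pose chk s o := vertex s o ==> has (edge s o) (iota 0 16).
have: chk s o by apply: (all16P2 (P := chk)); vm_compute.
move=> /implyP e /e /hasP[p]; rewrite mem_iota => /= ltp ed.
by exists (Ordinal ltp).
Qed.

Lemma assessorsP (a : ipair) :
  reflect (exists s o : idx, vertex s o /\ a = assessor s o)
          (a \in assessors R).
Proof.
rewrite inE; apply: (iffP existsP) => [[b]|[s [o [so ->]]]].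
  case/co_assessorsP => s [o [p [sop -> _]]]; exists s, o; split=> //.
  by case/and4P: sop.
by have [p /co_assessors_edge] := edge_exists so; exists (assessor s p).
Qed.

(** * The seven box-kites and their partition of the Assessors *)

Definition kite (s : idx) : {set ipair} :=
  [set assessor s o | o in octonion_indices :\ s].

Lemma vertexE (s o : idx) : s \in octonion_indices ->
  vertex s o = (o \in octonion_indices :\ s).
Proof. by rewrite !inE /vertex => ->; rewrite /= andbC. Qed.

Lemma kiteP (s : idx) (a : ipair) : s \in octonion_indices ->
  reflect (exists2 o : idx, vertex s o & a = assessor s o) (a \in kite s).
Proof.
move=> s8; apply: (iffP imsetP) => -[o so ->]; exists o => //.
  by rewrite vertexE.
by rewrite -vertexE.
Qed.

Lemma card_octonion_indices : #|octonion_indices| = 7.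
Proof. by rewrite (card_set_ord _ (fun i => 0 < i < 8)). Qed.

Lemma card_kite (s : idx) : s \in octonion_indices -> #|kite s| = 6.
Proof.
move=> s8; rewrite card_in_imset => [|o p].
  by have := cardsD1 s octonion_indices;
    rewrite card_octonion_indices s8 => -[].
by rewrite -!vertexE // => so sp /(assessor_inj so sp)[].
Qed.

(* A representative of each of the three axes of the box-kite s. *)
Definition axes (s : nat) : seq nat :=
  [seq o <- iota 1 7 | vertex s o & o < Nat.lxor s o].

(** The default 0 is not reached for an Octonion index [s] and [k < 3]: the six vertices form three
    axes. *)
Definition corner (s k : nat) (b : bool) : nat :=
  let o := nth 0 (axes s) k in if b then o else Nat.lxor s o.

Lemma corner_spec (s : idx) (k l : 'I_3) (b c : bool) :
  s \in octonion_indices ->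
  [&& corner s k b < 16, vertex s (corner s k b),
      edge s (corner s k b) (corner s l c) == (k != l) &
      (corner s k b == corner s l c) ==> (k == l) && (b == c)].
Proof.
pose chk (s k l : nat) (b c : bool) :=
  [&& corner s k b < 16, vertex s (corner s k b),
      edge s (corner s k b) (corner s l c) == (k != l) &
      (corner s k b == corner s l c) ==> (k == l) && (b == c)].
pose bools := [:: false; true].
have inb (d : bool) : d \in bools by case: d.
have: (0 < s < 8) ==> all (fun k => all (fun l => all (fun b =>
    all (chk s k l b) bools) bools) (iota 0 3)) (iota 0 3).
  apply: (all16P (P := fun s => (0 < s < 8) ==> all (fun k => all (fun l =>
    all (fun b => all (chk s k l b) bools) bools) (iota 0 3)) (iota 0 3))).
  by vm_compute.
rewrite inE => /implyP + s8 => /(_ s8)/all_iota_ord/(_ k)/all_iota_ord/(_ l).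
by move=> /allP/(_ b (inb b))/allP/(_ c (inb c)).
Qed.

(** Edges preserve the strut constant, so an octahedron lies in a single [kite s], and both have six
    elements. Conversely, the [corner] labels arrange [kite s] as an octahedron. *)
Lemma box_kiteP (K : {set ipair}) :
  reflect (exists2 s, s \in octonion_indices & K = kite s) (box_kite R K).
Proof.
apply: (iffP existsP) => [[v /and5P[/injectiveP vinj /eqP KE _ + _]]|[s s8 ->]].
  move=> /forallP adj.
  have {}adj x y : x.1 != y.1 -> co_assessors R (v x) (v y).
    exact/implyP/(forallP (adj x)).
  have /co_assessorsP[s [o [p [sop vo vp]]]] :
    co_assessors R (v (ord0, true)) (v (inord 1, true)).
    by apply: adj; rewrite -val_eqE /= inordK.
  have [so sp] : vertex s o /\ vertex s p by case/and4P: sop.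
  have s8 : s \in octonion_indices by rewrite inE; case/and3P: so.
  have co_kite (x y : 'I_3 * bool) : x.1 != y.1 ->
      v x \in kite s -> v y \in kite s.
    move=> xy /kiteP-/(_ s8)[q sq vx]; apply/kiteP => //.
    have /co_assessorsP[s' [q' [r [ed eq vy]]]] := adj _ _ xy.
    have [sq' sr] : vertex s' q' /\ vertex s' r by case/and4P: ed.
    move: eq; rewrite vx => /(assessor_inj sq sq')[-> _].
    by exists r.
  have v0 : v (ord0, true) \in kite s by apply/kiteP => //; exists o.
  have v1 : v (inord 1, true) \in kite s by apply/kiteP => //; exists p.
  exists s => //; apply/eqP; rewrite eqEcard card_kite // KE.
  rewrite card_imset // card_prod card_ord card_bool andbT.
  apply/subsetP=> _ /imsetP[[k b] _ ->].
  (* Vertices off axis 0 are adjacent to [v (ord0, true)], those on it to [v (inord 1, true)]. *)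
  have [->|k0] := eqVneq k ord0; last by apply: co_kite v0; rewrite eq_sym.
  by apply: co_kite v1; rewrite -val_eqE /= inordK.
pose w (x : 'I_3 * bool) : idx := inord (corner s x.1 x.2).
have wE x : w x = corner s x.1 x.2 :> nat.
  by rewrite inordK //; case/and4P: (corner_spec x.1 x.1 x.2 x.2 s8).
have w_vertex x : vertex s (w x).
  by rewrite wE; case/and4P: (corner_spec x.1 x.1 x.2 x.2 s8).
have w_co x y : co_assessors R (assessor s (w x)) (assessor s (w y)) =
    (x.1 != y.1).
  rewrite co_assessorsE // !wE.
  by case/and4P: (corner_spec x.1 y.1 x.2 y.2 s8) => _ _ /eqP.
have w_inj : injective (fun x => assessor s (w x)).
  move=> x y /(assessor_inj (w_vertex x) (w_vertex y))[_ /(congr1 val)].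
  rewrite /= !wE => /eqP xy.
  case/and4P: (corner_spec x.1 y.1 x.2 y.2 s8) => _ _ _.
  rewrite xy => /andP[/eqP xy1 /eqP xy2].
  by rewrite [x]surjective_pairing [y]surjective_pairing xy1 xy2.
have vE x : [ffun x => assessor s (w x)] x = assessor s (w x) by rewrite ffunE.
exists [ffun x => assessor s (w x)]; apply/and5P; split.
- by apply/injectiveP => x y; rewrite !vE => /w_inj.
- rewrite eq_sym eqEcard card_kite // card_imset => [|x y].
    rewrite card_prod card_ord card_bool andbT.
    apply/subsetP => _ /imsetP[x _ ->]; rewrite vE.
    by apply/kiteP => //; exists (w x).
  by rewrite !vE => /w_inj.
- apply/subsetP => a /kiteP-/(_ s8)[o so ->].
  by apply/assessorsP; exists s, o.
- by apply/forallP => x; apply/forallP => y; rewrite !vE w_co; apply/implyP.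
- by apply/forallP => k; rewrite !vE !w_co eqxx.
Qed.

Lemma box_kitesE : box_kites R = [set kite s | s in octonion_indices].
Proof.
apply/setP => K; rewrite inE.
by apply/box_kiteP/imsetP => -[s s8 ->]; exists s.
Qed.

Lemma kite_inj (s s' : idx) (a : ipair) : s \in octonion_indices ->
  s' \in octonion_indices -> a \in kite s -> a \in kite s' -> s = s'.
Proof.
move=> s8 s8' /kiteP-/(_ s8)[o so ->] /kiteP-/(_ s8')[o' so'].
by move=> /(assessor_inj so so')[].
Qed.

Lemma partition_box_kites : partition (box_kites R) (assessors R).
Proof.
rewrite box_kitesE; apply/and3P; split.
- apply/eqP/setP => a; apply/bigcupP/assessorsP.
    case=> _ /imsetP[s s8 ->] /kiteP-/(_ s8)[o so ->].
    by exists s, o.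
  case=> s [o [so ->]].
  have s8 : s \in octonion_indices by rewrite inE; case/and3P: so.
  by exists (kite s); [apply: imset_f|apply/kiteP => //; exists o].
- apply/trivIsetP => _ _ /imsetP[s s8 ->] /imsetP[s' s8' ->].
  apply: contraR => /pred0Pn[a /andP[/= as_ as']].
  by rewrite (kite_inj s8 s8' as_ as').
- by apply/imsetP => -[s /card_kite + e]; rewrite -e cards0.
Qed.

Lemma card_box_kites : #|box_kites R| = 7.
Proof.
rewrite box_kitesE card_in_imset ?card_octonion_indices // => s s' s8 s8' eqk.
have /card_gt0P[a as_] : 0 < #|kite s| by rewrite card_kite.
by apply: (kite_inj s8 s8' as_); rewrite -eqk.
Qed.

Lemma box_kites_complete : complete_box_kite_system R (box_kites R).
Proof.
split=> //; [exact: card_box_kites|exact: partition_box_kites|].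
rewrite (card_uniform_partition (n := 6) _ partition_box_kites) => [|K].
  by rewrite card_box_kites.
by rewrite box_kitesE => /imsetP[s s8 ->]; apply: card_kite.
Qed.

(** * Productions *)

Definition trip_seq (t : trip) : seq nat := [:: t.1.1; t.1.2; t.2].

Lemma in_trip_set (t : trip) (i : idx) : t \in O_trips ->
  (i \in trip_set t) = (val i \in trip_seq t).
Proof.
move=> tO; have: all (fun k => k < 16) (trip_seq t).
  have /allP : all (fun t => all (fun k => k < 16) (trip_seq t)) O_trips by [].
  exact.
case: t {tO} => [[a b] c] /and4P[/= a16 b16 c16 _].
by rewrite !inE -!val_eqE /= !inordK // orbA.
Qed.

Definition avoids_trip (S : nat) (t : trip) : bool :=
  all (fun a => S != Nat.lxor 8 a) (trip_seq t).

Lemma in_automorpheme (t : trip) (S : idx) : t \in O_trips ->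
  8 < S -> avoids_trip S t -> S \in automorpheme t.
Proof.
move=> tO S8 /allP avS; rewrite inE; apply/orP; right.
rewrite !inE (ltnW S8) -val_eqE /= val_eight_ball neq_ltn S8 orbT /=.
apply/forall_inP => a; rewrite in_trip_set // => /avS.
by rewrite -val_eqE /= val_ixor val_eight_ball.
Qed.

(* Both automorphemes containing (a, B) can play the role of the known one in
   Rule #3, so the rule yields every Co-Assessor of (a, B). *)
Lemma produces_co_assessor (T : {set ipair}) (s o p : idx) :
  edge s o p -> assessor s o \in T -> produces R T [set assessor s p].
Proof.
move=> sop oT; have [so sp] : vertex s o /\ vertex s p by case/and4P: sop.
pose good (s o p : nat) (u u' : trip) :=
  [&& o \in trip_seq u, avoids_trip (partnern s o) u, o \in trip_seq u',
      avoids_trip (partnern s o) u', u' != u & p \in trip_seq u'].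
(* Of the two O-trips through [o] whose automorphemes contain the partner of [o], [u'] is the one
   containing [p]. *)
pose chk s o p := if edge s o p then
  has (fun u => has (good s o p u) O_trips) O_trips else true.
have: chk s o p by apply: (all16P3 (P := chk)); vm_compute.
rewrite /chk sop => /hasP[u uO /hasP[u' uO']].
case/and5P => ou avu ou' avu' /andP[uu' pu'].
have [t zp] := edge_zero_product sop.
have [o8 so8] : o \in octonion_indices /\ 8 < partner s o.
  by rewrite inE val_partner partnern_ge8 //; case/and3P: so.
have sp8 : 8 < partner s p by rewrite val_partner partnern_ge8.
apply: (rule3 (u := u) (u' := u') (a := o) (B := partner s o)) zp => //.
- by apply/assessorsP; exists s, o.
- by rewrite inE ltnW.
- by rewrite in_trip_set.
- by apply: in_automorpheme => //; rewrite val_partner.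
- by rewrite in_trip_set.
- by apply: in_automorpheme => //; rewrite val_partner.
- by rewrite in_trip_set.
- by case/and4P: sop.
- by rewrite inE ltnW.
Qed.

(** By [partner_ixor], any edge between [o] and o+s+s' has its exchanged pairs in box-kite [s']; a
    search finds such an edge whose signs also allow Rule #2. *)
Lemma produces_twist (T : {set ipair}) (s s' : idx) :
  s \in octonion_indices -> s' \in octonion_indices -> s != s' ->
  kite s \subset T ->
  exists o p : idx, [/\ vertex s' o, vertex s' p &
    produces R T [set assessor s' o; assessor s' p]].
Proof.
move=> s8 s8' ss' /subsetP sT.
pose good (s s' o p : nat) t :=
  if edge s o p && vertex s' o && vertex s' p then
    zero_productn o false (partnern s o) p t (partnern s p) &&
    (zero_productn o (~~ t) (partnern s p) p false (partnern s o) ||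
     zero_productn o t (partnern s p) p true (partnern s o))
  else false.
(* The second vertex is determined by the first, so only [o] and the sign [t] are searched. *)
pose chk s s' := [&& 0 < s < 8, 0 < s' < 8 & s != s'] ==>
  has (fun o => has (good s s' o (Nat.lxor o (Nat.lxor s s'))) [:: false; true])
    (iota 0 16).
have: chk s s' by apply: (all16P2 (P := chk)); vm_compute.
move: (s8) (s8'); rewrite /chk !inE => -> ->; rewrite ss' implyTb.
case/hasP=> o'; rewrite mem_iota => o16 /hasP[t _].
pose o : idx := Ordinal o16; pose p := ixor o (ixor s s').
rewrite -[o']/(val o) -!val_ixor -/p /good.
case: ifP => // /andP[/andP[sop so'] sp'] /andP[zp zp'].
have [so sp] : vertex s o /\ vertex s p by case/and4P: sop.
have eqp : partner s p = partner s' o := partner_ixor s s' o.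
have eqo : partner s o = partner s' p.
  by rewrite -(partner_ixor s') [ixor s' s]ixorC.
exists o, p; split=> //; rewrite /assessor -eqp -eqo.
apply: (rule2 (s := false) (t := t)).
- by apply/sT/kiteP => //; exists o.
- by apply/sT/kiteP => //; exists p.
- exact: co_assessors_edge.
- by rewrite zero_productE ?val_partner; last exact: vertex_neq_partner;
    last exact: vertex_neq_partner.
- have op : o != partner s p by rewrite eqp vertex_neq_partner.
  have po : p != partner s o by rewrite eqo vertex_neq_partner.
  by apply/orP; rewrite !(zero_productE R _ _ op po) !val_partner.
Qed.

(** A single twist links any two distinct box-kites. *)
Lemma box_kites_interconnected : interconnected R (box_kites R).
Proof.
move=> K K'; rewrite box_kitesE => /imsetP[s s8 ->] /imsetP[s' s8' ->].
have [->|ss'] := eqVneq s s'; first exact: rt_refl.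
apply: rt_step; split; try exact: imset_f.
have [o [p [so sp prod]]] := produces_twist s8 s8' ss' (subxx (kite s)).
exists [set assessor s' o; assessor s' p] => //.
by rewrite subUset !sub1set; apply/andP; split; apply/kiteP => //;
  [exists o|exists p].
Qed.

(** * Unfolding the whole system *)

Definition co_closed (T : {set ipair}) : bool :=
  [forall a in T, forall b, co_assessors R a b ==> (b \in T)].

(** An octahedron has diameter two: the opposite vertex is reached through a common neighbour. *)
Lemma co_closed_kite (T : {set ipair}) (s o : idx) : co_closed T ->
  vertex s o -> assessor s o \in T -> kite s \subset T.
Proof.
move=> /forall_inP clT so oT.
have edgeT (p q : idx) : edge s p q -> assessor s p \in T -> assessor s q \in T.
  by move=> /co_assessors_edge co /clT/forallP/(_ (assessor s q))/implyP; apply.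
have s8 : s \in octonion_indices by rewrite inE; case/and3P: so.
apply/subsetP => _ /kiteP-/(_ s8)[q sq ->].
pose chk s o q := vertex s o && vertex s q ==>
  [|| o == q, edge s o q | has (fun p => edge s o p && edge s p q) (iota 0 16)].
have: chk s o q by apply: (all16P3 (P := chk)); vm_compute.
rewrite /chk so sq implyTb => /or3P[/eqP/val_inj<- // | /edgeT | /hasP[p]].
  exact.
rewrite mem_iota => /= p16; rewrite -[p]/(val (Ordinal p16 : idx)).
by case/andP=> /edgeT op /edgeT; apply; apply: op.
Qed.

Lemma production_progress (T : {set ipair}) : T \subset assessors R ->
  T != set0 -> T != assessors R ->
  exists N, [/\ produces R T N, N \subset assessors R & ~~ (N \subset T)].
Proof.
move=> TA /set0Pn[a aT] TnA.
have [clT|] := boolP (co_closed T); last first.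
  case/forall_inPn => {}a {}aT /forallPn[b]; rewrite negb_imply => /andP[].
  case/co_assessorsP=> s [o [p [sop ea ->]]] bT.
  exists [set assessor s p]; split; last by rewrite sub1set.
    by apply: produces_co_assessor sop _; rewrite -ea.
  by rewrite sub1set; apply/assessorsP; exists s, p; case/and4P: sop.
have /subsetPn[b /assessorsP[s' [o' [so' ->]]] bT] : ~~ (assessors R \subset T).
  by apply: contra TnA => AT; rewrite eqEsubset TA.
have /assessorsP[s [o [so ea]]] := subsetP TA a aT.
have s8 : s \in octonion_indices by rewrite inE; case/and3P: so.
have s8' : s' \in octonion_indices by rewrite inE; case/and3P: so'.
have [kT kT'] : kite s \subset T /\ ~~ (kite s' \subset T).
  split; first by apply: co_closed_kite so _; rewrite -?ea.
  apply/subsetPn; exists (assessor s' o') => //.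
  by apply/kiteP => //; exists o'.
have ss' : s != s' by apply: contraTneq kT => ->.
have [p [q [sp sq prod]]] := produces_twist s8 s8' ss' kT.
exists [set assessor s' p; assessor s' q]; split=> //.
  rewrite subUset !sub1set; apply/andP; split; apply/assessorsP.
    by exists s', p.
  by exists s', q.
(* Were the twisted Assessors already in [T], closure would put all of [kite s'] in [T]. *)
apply: contra kT'; rewrite subUset sub1set => /andP[pT _].
exact: co_closed_kite sp pT.
Qed.

(** Induction on the number of missing Assessors, which each progress step lowers. *)
Lemma unfolds_assessors (T : {set ipair}) : T \subset assessors R ->
  T != set0 -> unfolds R T (assessors R).
Proof.
have [n] := ubnP #|assessors R :\: T|; elim: n => // n IHn in T *.
rewrite ltnS => leTn TA T0.
have [->|TnA] := eqVneq T (assessors R); first exact: rt_refl.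
have [N [prod NA NT]] := production_progress TA T0 TnA.
apply: rt_trans (rt_step _ _ _ (T :|: N) _) _; first by exists N.
apply: IHn; first last.
- by apply: contra T0; rewrite setU_eq0 => /andP[].
- by rewrite subUset TA.
apply: leq_trans leTn; apply/proper_card/properP; split.
  by rewrite setDS // subsetUl.
have /subsetPn[b bN bT] := NT.
exists b; first by rewrite inE bT (subsetP NA).
by rewrite !inE bN orbT.
Qed.

(** The strut constant is 8+o+S (in XOR). Excluding S = 8 keeps it different from [o], and excluding
    S = 8+o keeps it nonzero. *)
Lemma assessor_choice (o S : idx) : o \in octonion_indices ->
  S \in sedenion_choices o -> [set o; S] \in assessors R.
Proof.
move=> o8 So; apply/assessorsP; exists (ixor eight_ball (ixor o S)), o.
split; last exact: set2_assessor.
pose chk o S := [&& 0 < o < 8, 8 <= S, S != 8 & S != Nat.lxor 8 o] ==>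
  vertex (Nat.lxor 8 (Nat.lxor o S)) o.
have: chk o S by apply: (all16P2 (P := chk)); vm_compute.
rewrite !val_ixor val_eight_ball => /implyP; apply.
move: o8 So; rewrite !inE -!val_eqE /= val_ixor val_eight_ball => ->.
exact.
Qed.

Lemma choices_system_unfolds (o S : idx) : o \in octonion_indices ->
  S \in sedenion_choices o -> system_unfolds_from R o S.
Proof.
move=> o8 So; exists (box_kites R); split.
- exact: box_kites_complete.
- exact: box_kites_interconnected.
rewrite (cover_partition partition_box_kites); apply: unfolds_assessors.
  by rewrite sub1set assessor_choice.
by apply/set0Pn; exists [set o; S]; rewrite inE.
Qed.

End BoxKites.

(** * Counting the choices, and the theorem *)

Lemma card_sedenion_choices (o : idx) : o \in octonion_indices ->
  #|sedenion_choices o| = 6.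
Proof.
pose P (o S : nat) := [&& 8 <= S, S != 8 & S != Nat.lxor 8 o].
have -> : sedenion_choices o = [set S : idx | P o S].
  by apply/setP=> S; rewrite !inE -!val_eqE /= val_ixor val_eight_ball.
rewrite card_set_ord inE => o8; apply/eqP; move: o8; apply: implyP.
apply: (all16P (P := fun o => (0 < o < 8) ==> (count (P o) (iota 0 16) == 6))).
by vm_compute.
Qed.

Lemma card_pure_sedenion_indices : #|sedenion_indices :\ eight_ball| = 7.
Proof.
have -> : sedenion_indices :\ eight_ball = [set S : idx | 8 < S].
  apply/setP=> S; rewrite !inE -val_eqE /= val_eight_ball.
  by rewrite [RHS]ltn_neqAle eq_sym.
by rewrite (card_set_ord _ (fun S => 8 < S)).
Qed.

Lemma card_octonion_choices (S : idx) : S \in sedenion_indices :\ eight_ball ->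
  #|octonion_choices S| = 6.
Proof.
pose P (S o : nat) := (0 < o < 8) && (o != Nat.lxor S 8).
have -> : octonion_choices S = [set o : idx | P S o].
  by apply/setP=> o; rewrite !inE -!val_eqE /= val_ixor val_eight_ball.
rewrite card_set_ord !inE -val_eqE /= val_eight_ball => S8.
apply/eqP; move: S8; apply: implyP.
apply: (all16P (P := fun S => (S != 8) && (8 <= S) ==>
  (count (P S) (iota 0 16) == 6))).
by vm_compute.
Qed.

Theorem mainTheorem5 (R : realType) :
  [/\ #|octonion_indices| = 7,
      forall o : idx, o \in octonion_indices -> #|sedenion_choices o| = 6 &
      forall o S : idx, o \in octonion_indices -> S \in sedenion_choices o ->
        system_unfolds_from R o S]
  /\
  [/\ #|sedenion_indices :\ eight_ball| = 7,
      forall S : idx, S \in sedenion_indices :\ eight_ball ->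
        #|octonion_choices S| = 6 &
      forall S o : idx, S \in sedenion_indices :\ eight_ball ->
        o \in octonion_choices S -> system_unfolds_from R o S].
Proof.
split; split; [exact: card_octonion_indices|exact: card_sedenion_choices|
  exact: choices_system_unfolds|exact: card_pure_sedenion_indices|
  exact: card_octonion_choices|].
move=> S o; rewrite in_setD1 => /andP[Sn8 S8]; rewrite inE => /andP[o8 oS].
apply: choices_system_unfolds => //; rewrite inE S8 Sn8.
(* The second order of choice reduces to the first: S = 8+o gives o = S+8 (in XOR). *)
by apply: contraNneq oS => ->; rewrite ixorC ixorK.
Qed.
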